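(* Let $m, n_0, n_1$ be positive integers with $m \geq 4$, $\gcd(n_0, n_1) = 1$ and $\gcd(n_1, m) = 1$, and put $n(\lambda) = n_0 + n_1\lambda$. Consider the equation $$\frac{m}{n_0 + n_1\lambda} = \frac{1}{x(\lambda)} + \frac{1}{y(\lambda)} + \frac{1}{z(\lambda)} \qquad (\ast)$$ in polynomials $x(\lambda), y(\lambda), z(\lambda)$ with positive integer coefficients, required to hold identically in $\lambda$. Then $(\ast)$ has such a solution if and only if there exist positive integers $l, k, s, r$ such that (i) $n_1 = l(mk-1)$, (ii) $s n_1 = kl + r n_0$, (iii) $skl/r$ is a positive integer. In that case $$x(\lambda) = k\,n(\lambda),\qquad z(\lambda) = \frac{kl}{r}(s + r\lambda),\qquad y(\lambda) = n(\lambda)(s + r\lambda)$$ is a solution. Moreover, every solution of $(\ast)$ in polynomials with positive integer coefficients is, up to a permutation of $x, y, z$, of this form for some positive integers $l, k, s, r$ satisfying (i)–(iii).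
   Context: $\lambda$ is an indeterminate. *)

(* Defs.v *)
From HB Require Import structures.
From mathcomp Require Import all_boot all_order all_algebra fraction.
Set Implicit Arguments. Unset Strict Implicit. Unset Printing Implicit Defensive.
Import Order.TTheory GRing.Theory Num.Theory.
Local Open Scope ring_scope.

Notation ratfun := {fraction {poly int}}.
Definition tofrac (p : {poly int}) : ratfun := @FracField.tofrac _ p.

Definition npoly (n0 n1 : nat) : {poly int} := (n0%:R)%:P + n1%:R *: 'X.

Definition pos_poly (p : {poly int}) : Prop :=
  p != 0 /\ forall i : nat, (i < size p)%N -> 0 < p`_i.

Definition is_sol (m n0 n1 : nat) (x y z : {poly int}) : Prop :=
  tofrac (m%:R : {poly int}) / tofrac (npoly n0 n1)
  = (tofrac x)^-1 + (tofrac y)^-1 + (tofrac z)^-1.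

Definition conds (m n0 n1 l k s r : nat) : Prop :=
  [/\ (0 < l)%N /\ (0 < k)%N /\ (0 < s)%N /\ (0 < r)%N,
      n1 = (l * (m * k - 1))%N,
      (s * n1 = k * l + r * n0)%N
    & (r %| s * k * l)%N].

Definition xsol (n0 n1 k : nat) : {poly int} := (k%:R) *: npoly n0 n1.
Definition ysol (n0 n1 s r : nat) : {poly int} :=
  npoly n0 n1 * ((s%:R)%:P + r%:R *: 'X).
(* z = (kl/r)(s + r lambda) = (skl/r) + kl lambda *)
Definition zsol (k l s r : nat) : {poly int} :=
  (((s * k * l) %/ r)%N%:R)%:P + (k * l)%N%:R *: 'X.

(* Main.v *)
(** Clear denominators to [m x y z = n (y z + x z + x y)].  Comparing degrees and
    leading coefficients (with [gcd (n1, m) = 1]), two of the three polynomials,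
    say [x] and [z], are linear.  Since [n] is primitive, vanishing at its root
    [- n0 / n1] means divisibility by [n] over the integers, and one of [x], [y],
    [z] vanishes there.

    If [x = k n], then one of the others, say [y], is [n V], and
    [V ((m k - 1) z - k n) = k z].  A constant [V] is impossible because [m >= 4];
    so [V = s + r X], the other factor is a constant, and comparing coefficients
    gives [l] and the three conditions.

    If only [y = n V] vanishes, then [V (m x z - n (x + z)) = x z] with [V] of
    degree 1 or 2.  In degree 2, [m x z - n (x + z)] is a positive constant, against
    the signs of the residues of [1 / y] at its three simple poles.  In degree 1,
    [x], [z] and [V] are proportional, and [m] would divide [n1]. *)

Require Import Defs.
From HB Require Import structures.
From mathcomp Require Import all_boot all_order all_algebra fraction.
From mathcomp Require Import ring zify.
Set Implicit Arguments. Unset Strict Implicit. Unset Printing Implicit Defensive.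
Import Order.TTheory GRing.Theory Num.Theory.
Import Defs.
Local Open Scope ring_scope.

(** * Clearing denominators; sizes and coefficients of integer polynomials *)

Lemma sum3_inv (F : fieldType) (a n x y z : F) : n != 0 -> x != 0 -> y != 0 -> z != 0 ->
  a / n = x^-1 + y^-1 + z^-1 <-> a * (x * y * z) = n * (y * z + x * z + x * y).
Proof.
move=> n0 x0 y0 z0.
have -> : x^-1 + y^-1 + z^-1 = (y * z + x * z + x * y) / (x * y * z).
  by field; rewrite x0 y0 z0.
have xyz0 : x * y * z != 0 by rewrite !mulf_neq0.
by split=> [/eqP|e]; [|apply/eqP]; rewrite eqr_div // ?e; [move/eqP ->|]; rewrite mulrC.
Qed.

Lemma coef_natM (c : nat) (p : {poly int}) i : (c%:R * p)`_i = c%:Z * p`_i.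
Proof. by rewrite mulr_natl coefMn -mulr_natl natz. Qed.

Lemma natM_scale (c : nat) (p : {poly int}) : c%:R * p = (c%:R : int) *: p.
Proof. by rewrite scaler_nat mulr_natl. Qed.

Section EgyptianFraction.
Variables m n0 n1 : nat.

Lemma npoly_coef0 : (npoly n0 n1)`_0 = n0%:Z.
Proof. by rewrite /npoly !coefE /= mulr0 addr0 natz. Qed.

Lemma npoly_coef1 : (npoly n0 n1)`_1 = n1%:Z.
Proof. by rewrite /npoly !coefE /= mulr1 add0r natz. Qed.

Lemma lead_coef_gt0_neq0 (p : {poly int}) : 0 < lead_coef p -> p != 0.
Proof. by rewrite -lead_coef_eq0 => /lt0r_neq0. Qed.

Lemma pos_poly_lead_coef_gt0 (p : {poly int}) : pos_poly p -> 0 < lead_coef p.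
Proof. by case=> p0 pp; apply: pp; rewrite ltn_predL size_poly_gt0. Qed.

(** Positive leading coefficients cannot cancel, even when the sizes agree. *)
Lemma size_add_lead_coef_gt0 (p q : {poly int}) : 0 < lead_coef p -> 0 < lead_coef q ->
  0 < lead_coef (p + q) /\ size (p + q) = maxn (size p) (size q).
Proof.
move=> p0 q0; case: (ltngtP (size p) (size q)) => h.
- by rewrite addrC lead_coefDl // size_polyDl.
- by rewrite lead_coefDl // size_polyDl.
have sD : size (p + q) = size q.
  apply/eqP; rewrite eqn_leq (leq_trans (size_polyD _ _)) ?h ?maxnn //=.
  rewrite leqNgt; apply/negP => lt.
  have : (p + q)`_(size q).-1 = 0.
    by apply: nth_default; rewrite -ltnS prednK // size_poly_gt0 lead_coef_gt0_neq0.
  by rewrite coefD -{1}h -!lead_coefE; lia.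
by split; rewrite ?h ?maxnn // lead_coefE sD coefD -{1}h -!lead_coefE addr_gt0.
Qed.

Lemma poly_size2 (p : {poly int}) : (size p <= 2)%N -> p = (p`_0)%:P + p`_1 *: 'X.
Proof.
move=> s; apply/polyP => -[|[|i]]; rewrite !coefE /= ?mulr0 ?addr0 ?mulr1 ?add0r //.
by rewrite nth_default // (leq_trans s).
Qed.

Hypotheses (n0_gt0 : (0 < n0)%N) (n1_gt0 : (0 < n1)%N).

Lemma size_npoly : size (npoly n0 n1) = 2%N.
Proof.
have sX : size ((n1%:R : int) *: 'X) = 2%N by rewrite size_scale ?size_polyX //; lia.
by rewrite /npoly addrC size_polyDl ?sX // size_polyC; case: (_ != _).
Qed.
Lemma lead_coef_npoly : lead_coef (npoly n0 n1) = n1%:Z.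
Proof. by rewrite lead_coefE size_npoly /npoly !coefE /= mulr1 add0r natz. Qed.

(** * Divisibility by n over the integers *)

Hypothesis co01 : coprime n0 n1.

Definition rootn : rat := - n0%:R / n1%:R.
Local Notation pZQ := (map_poly (intr : int -> rat)).

(** Gauss's lemma: n is primitive because its coefficients are coprime, so divisibility over the
    rationals descends to the integers. *)
Lemma dvd_npoly_root (p : {poly int}) : root (pZQ p) rootn -> exists V : {poly int}, p = npoly n0 n1 * V.
Proof.
have n1Q : n1%:R != 0 :> rat by rewrite pnatr_eq0 -lt0n.
have En : pZQ (npoly n0 n1) = n1%:R *: ('X - rootn%:P).
  rewrite /npoly rmorphD /= map_polyC map_polyZ map_polyX /= !rmorph_nat.
  rewrite scalerBr -mul_polyC -[in RHS]mul_polyC -polyCM /rootn mulrC.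
  rewrite mulrCA divff // mulr1 polyCN opprK; ring.
move=> rp; have : pZQ (npoly n0 n1) %| pZQ p.
  by rewrite En dvdpZl // dvdp_XsubCl.
(* [q] is an integer factor of [p] proportional to n over the rationals. The relation n0 q_1 = n1
   q_0 and coprimality then make [q] an integer multiple [t] of n. *)
case/dvdpP_rat_int => q [a a0 Eq] [r Er].
have sq : size q = 2%N.
  by rewrite -size_rat_int_poly -(size_scale _ a0) -Eq size_rat_int_poly size_npoly.
have e0 : n0%:R = a * (q`_0)%:~R.
  by have := congr1 (fun p : {poly rat} => p`_0) Eq; rewrite coefZ !coef_map /= npoly_coef0 -pmulrn.
have e1 : n1%:R = a * (q`_1)%:~R.
  by have := congr1 (fun p : {poly rat} => p`_1) Eq; rewrite coefZ !coef_map /= npoly_coef1 -pmulrn.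
have ez : n0%:Z * q`_1 = n1%:Z * q`_0.
  apply/eqP; rewrite -(eqr_int rat) !rmorphM /= -!pmulrn e0 e1; apply/eqP; ring.
have : (n0%:Z %| q`_0)%Z.
  have /Gauss_dvdzr <- : coprimez n0%:Z n1%:Z by [].
  by rewrite -ez dvdz_mulr.
case/dvdzP => t Et.
have n0z : n0%:Z != 0 by lia.
have Et1 : q`_1 = t * n1%:Z.
  by apply: (mulfI n0z); rewrite ez Et; ring.
exists (t%:P * r); rewrite Er (@poly_size2 q) ?sq // Et Et1 /npoly -!mul_polyC !natz !polyCM; ring.
Qed.


(** * The cleared equation, and the parameters when x and y are multiples of n *)

Hypotheses (m_ge4 : (4 <= m)%N) (co1m : coprime n1 m).

Lemma is_solE (x y z : {poly int}) : x != 0 -> y != 0 -> z != 0 ->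
  is_sol m n0 n1 x y z <->
  m%:R * (x * y * z) = npoly n0 n1 * (y * z + x * z + x * y).
Proof.
move=> x0 y0 z0; rewrite /is_sol /tofrac.
have n0' : npoly n0 n1 != 0 by rewrite -size_poly_gt0 size_npoly.
by rewrite sum3_inv ?tofrac_eq0 // -!(tofracM, tofracD); split=> [/eqP|->//]; rewrite tofrac_eq => /eqP.
Qed.

(** The equation in [V] and [z] is what remains for x = k n and y = n V after cancelling n^2. *)
Lemma conds_of_factor (k : nat) (V z : {poly int}) : (0 < k)%N -> 0 < lead_coef V ->
  pos_poly z -> V * ((m * k - 1)%N%:R * z - k%:R * npoly n0 n1) = k%:R * z ->
  exists l s r : nat, [/\ conds m n0 n1 l k s r, V = (s%:R)%:P + r%:R *: 'X & z = zsol k l s r].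
Proof.
move=> k0 lV pz; set M := (m * k - 1)%N => E.
have ME : (M%:Z = m%:Z * k%:Z - 1) by rewrite /M; nia.
have z_neq0 : z != 0 by case: pz.
have [sV|sV] := leqP (size V) 1.
  have VE := @size1_polyC _ V sV; set v := V`_0 in VE.
  have v0 : 0 < v by move: lV; rewrite VE lead_coefC.
  have Ei i : v * (M%:Z * z`_i - k%:Z * (npoly n0 n1)`_i) = k%:Z * z`_i.
    by have := congr1 (fun p : {poly int} => p`_i) E; rewrite VE coefCM coefB !coef_natM.
  have := Ei 0; have := Ei 1; rewrite npoly_coef0 npoly_coef1 => E1 E0.
  (* For a constant V = v the equation reads (v M - k) z = k v n. A Bezout combination of its
     coefficients shows that v M - k divides k v, yet m >= 4 makes it larger than k v. *)
  have [u [w uw]] : exists u w : int, u * n0%:Z + w * n1%:Z = 1.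
    have /coprimezP [[u w] /= h] : coprimez n0%:Z n1%:Z by [].
    by exists u, w.
  have : (v * M%:Z - k%:Z) * (u * z`_0 + w * z`_1) = k%:Z * v.
    rewrite -[RHS]mulr1 -uw; apply/eqP; rewrite -subr_eq0; apply/eqP.
    transitivity (u * (v * (M%:Z * z`_0 - k%:Z * n0%:Z) - k%:Z * z`_0)
      + w * (v * (M%:Z * z`_1 - k%:Z * n1%:Z) - k%:Z * z`_1)); first by ring.
    by rewrite E0 E1 !subrr !mulr0.
  set T := v * M%:Z - k%:Z; set q := _ + _ => Tq.
  have TT : k%:Z * v < T by rewrite /T ME; nia.
  have q0 : 0 < q by nia.
  nia.
set q := _ * z - _ in E.
have q0 : q != 0.
  apply: contra_neq z_neq0 => q0; move/eqP: E; rewrite q0 mulr0 eq_sym natM_scale -mul_polyC mulf_eq0 polyC_eq0.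
  by case/orP => [|/eqP //]; lia.
have V0 := lead_coef_gt0_neq0 lV.
have sE : (size V + size q).-1 = size z.
  by rewrite -size_mul // E natM_scale size_scale //; lia.
have sq : (size q > 0)%N by rewrite size_poly_gt0.
have M0 : (0 < M)%N by lia.
(* If [z] had degree at least 2, subtracting k n would not lower the degree of M z, so [q] would
   have the size of [z] and [V] would be constant. *)
have sz2 : (size z <= 2)%N.
  rewrite leqNgt; apply/negP => sz.
have lt_aux (a b c : nat) : a = 2%N -> (2 < c)%N -> (c <= b)%N ->
    (maxn (a + c).-1 (a + b).-1 < (b + c).-1)%N by lia.
  have : size q = size z; last by lia.
  rewrite /q size_polyDl natM_scale; first by rewrite size_scale //; lia.
  by rewrite size_polyN natM_scale !size_scale ?size_npoly //; lia.
have sV2 : size V = 2%N by lia.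
have sq1 : size q = 1%N by lia.
have szz : size z = 2%N by lia.
have VE := @poly_size2 V; rewrite sV2 in VE; move/(_ isT): VE.
move: lV; rewrite lead_coefE sV2 /=; set r := V`_1; set s := V`_0 => r0 VE.
have zE := poly_size2 sz2.
have z0 : 0 < z`_0 by case: pz => _; apply; rewrite szz.
have z1 : 0 < z`_1 by case: pz => _; apply; rewrite szz.
have q1 : M%:Z * z`_1 = k%:Z * n1%:Z.
  by apply/eqP; rewrite -subr_eq0 -npoly_coef1 -!coef_natM -coefB nth_default // sq1.
have qE := @size1_polyC _ q; rewrite sq1 in qE; move/(_ isT): qE.
have : q`_0 = M%:Z * z`_0 - k%:Z * n0%:Z by rewrite /q coefB !coef_natM npoly_coef0.
set D := q`_0 => DE qE.
have Ei i : V`_i * D = k%:Z * z`_i.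
  by have := congr1 (fun p : {poly int} => p`_i) E; rewrite qE coefMC coef_natM.
have Es : s * D = k%:Z * z`_0 by exact: Ei.
have Er : r * D = k%:Z * z`_1 by exact: Ei.
have D0 : 0 < D by nia.
have s0 : 0 < s by nia.
(* Since [q] is constant, M z_1 = k n1; and m k - M = 1 makes M and k coprime. The quotient n1 / M
   is the parameter l, whence z_1 = k l. *)
have : (M%:Z %| n1%:Z)%Z.
  have cMk : coprimez M%:Z k%:Z.
    by apply/coprimezP; exists (-1, m%:Z) => /=; rewrite ME; ring.
  by rewrite -(Gauss_dvdzr _ cMk) -q1 dvdz_mulr.
case/dvdzP => l' El'.
have l'0 : 0 < l' by nia.
have [l ll] : exists l : nat, l' = l%:Z by exists `|l'|%N; lia.
have [s' ss] : exists s' : nat, s = s'%:Z by exists `|s|%N; lia.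
have [r' rr] : exists r' : nat, r = r'%:Z by exists `|r|%N; lia.
have Ez1 : z`_1 = k%:Z * l%:Z.
  apply: (@mulfI _ M%:Z); first by lia.
  by rewrite q1 El' ll; ring.
(* Eliminating D from s D = k z_0 and r D = k z_1 gives z_0 = s k l / r, which is condition
   (iii). *)
have Ez0 : r * z`_0 = k%:Z * l%:Z * s.
  apply: (@mulfI _ D); first by lia.
  transitivity ((r * D) * z`_0); first by ring.
  rewrite Er Ez1; transitivity (k%:Z * l%:Z * (k%:Z * z`_0)); first by ring.
  by rewrite -Es; ring.
have [z0' zz] : exists z0' : nat, z`_0 = z0'%:Z by exists `|(z`_0)%R|%N; lia.
have dz : (s' * k * l = r' * z0')%N by move: Ez0; rewrite zz ss rr; nia.
exists l, s', r'; split.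
- split; first by lia.
  + by move: El'; rewrite ll -/M; lia.
  (* Condition (ii) multiplied by D, where D = M z_0 - k n0 and n1 = l M. *)
  + have : D * (s * n1%:Z) = D * (k%:Z * l%:Z + r * n0%:Z).
      transitivity ((s * D) * n1%:Z); first by ring.
      transitivity (D * k%:Z * l%:Z + (r * D) * n0%:Z); last by ring.
      by rewrite Es Er Ez1 El' ll DE; ring.
    move/(mulfI (lt0r_neq0 D0)); rewrite ss rr; lia.
  + by rewrite dz dvdn_mulr.
- by rewrite VE ss rr !natz.
rewrite zE /zsol dz mulKn; last by lia.
by rewrite zz Ez1 !natz PoszM.
Qed.


(** * Vanishing at the root of n *)

Local Notation ev p := (pZQ p).[rootn].

Lemma ev_npoly : ev (npoly n0 n1) = 0.
Proof.
have n1Q : n1%:R != 0 :> rat by rewrite pnatr_eq0 -lt0n.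
rewrite /npoly rmorphD /= map_polyC map_polyZ map_polyX /= !rmorph_nat -polyC_natr hornerD hornerC hornerZ hornerX /rootn.
by field.
Qed.

Definition egypt_eq (x y z : {poly int}) :=
  m%:R * (x * y * z) = npoly n0 n1 * (y * z + x * z + x * y).

(** At the root of n the right-hand side vanishes, hence so does m x y z. *)
Lemma egypt_root (x y z : {poly int}) : egypt_eq x y z ->
  [\/ root (pZQ x) rootn, root (pZQ y) rootn | root (pZQ z) rootn].
Proof.
move=> /(congr1 (fun p : {poly int} => ev p)).
rewrite !(rmorphM, rmorph_nat, hornerM) /= ev_npoly mul0r -polyC_natr hornerC => /eqP.
rewrite !mulf_eq0 pnatr_eq0 => /orP[|/orP[/orP[]|]] h; last 3 first.
- exact: Or31. - exact: Or32. - exact: Or33.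
by lia.
Qed.

Lemma egypt_eqC12 (x y z : {poly int}) : egypt_eq x y z -> egypt_eq y x z.
Proof. by rewrite /egypt_eq => h; rewrite [y * x]mulrC h; ring. Qed.

Lemma egypt_eqC23 (x y z : {poly int}) : egypt_eq x y z -> egypt_eq x z y.
Proof. by rewrite /egypt_eq => h; rewrite mulrAC h; ring. Qed.

Lemma npoly_neq0 : npoly n0 n1 != 0.
Proof. by rewrite -size_poly_gt0 size_npoly. Qed.

Lemma xsolE k : xsol n0 n1 k = k%:R * npoly n0 n1.
Proof. by rewrite /xsol scaler_nat mulr_natl. Qed.

Lemma root_size2_xsol (x : {poly int}) : 0 < lead_coef x -> size x = 2%N -> root (pZQ x) rootn ->
  exists2 k, (0 < k)%N & x = xsol n0 n1 k.
Proof.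
move=> lx sx /dvd_npoly_root [X xE]; move: lx sx; rewrite xE.
have [-> | X0] := eqVneq X 0; first by rewrite mulr0 size_poly0.
rewrite size_mul ?npoly_neq0 // size_npoly /= => lx sX.
have XE : X = (X`_0)%:P by apply: size1_polyC; case: sX => h; exact: (eq_leq h).
move: lx; rewrite XE lead_coefM lead_coef_npoly lead_coefC => c0.
exists `|(X`_0)%R|%N; first by nia.
rewrite /xsol mulrC mul_polyC natz; congr (_ *: _); lia.
Qed.

(** Writing x = k n and y = n V and cancelling n^2 leads to the equation of [conds_of_factor]. *)
Lemma sol_of_two_roots (x y z : {poly int}) : pos_poly x -> pos_poly y -> pos_poly z -> egypt_eq x y z ->
  size x = 2%N -> root (pZQ x) rootn -> root (pZQ y) rootn ->
  exists l k s r, [/\ conds m n0 n1 l k s r, x = xsol n0 n1 k, y = ysol n0 n1 s r & z = zsol k l s r].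
Proof.
move=> px py pz e sx rx /dvd_npoly_root [V yE].
have [k k0 xE] := root_size2_xsol (pos_poly_lead_coef_gt0 px) sx rx.
have lV : 0 < lead_coef V.
  have := pos_poly_lead_coef_gt0 py.
  by rewrite yE lead_coefM lead_coef_npoly pmulr_rgt0 //; lia.
have [|l [s [r [c VE zE]]]] := @conds_of_factor k V z k0 lV pz; last first.
  by exists l, k, s, r; split=> //; rewrite yE VE.
apply: (mulfI npoly_neq0); apply: (mulfI npoly_neq0).
have mk : (m * k - 1)%N%:R = m%:R * k%:R - 1 :> {poly int}.
  by rewrite natrB ?natrM //; lia.
move: e; rewrite /egypt_eq xE yE xsolE mk => e.
apply/eqP; rewrite -subr_eq0; apply/eqP.
transitivity (m%:R * (k%:R * npoly n0 n1 * (npoly n0 n1 * V) * z) -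
  npoly n0 n1 * (npoly n0 n1 * V * z + k%:R * npoly n0 n1 * z + k%:R * npoly n0 n1 * (npoly n0 n1 * V))); first by ring.
by rewrite e subrr.
Qed.

(** After one factor n is cancelled, evaluation at its root leaves (m k - 1) y z = 0, and m k - 1 is
    nonzero. *)
Lemma egypt_xsol_root k y z : (0 < k)%N -> egypt_eq (xsol n0 n1 k) y z ->
  root (pZQ y) rootn \/ root (pZQ z) rootn.
Proof.
move=> k0; rewrite /egypt_eq xsolE => e.
have : m%:R * k%:R * y * z = y * z + k%:R * npoly n0 n1 * (y + z).
  apply: (mulfI npoly_neq0); transitivity (m%:R * (k%:R * npoly n0 n1 * y * z)); first by ring.
  by rewrite e; ring.
clear e; move: ev_npoly; move: (npoly n0 n1) => N N0 /(congr1 (fun p : {poly int} => ev p)).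
rewrite !(rmorphM, rmorphD, rmorph_nat, hornerM, hornerD) /= N0 -!polyC_natr !hornerC.
rewrite mulr0 mul0r addr0 => h.
have : (m%:R * k%:R - 1) * ((ev y) * (ev z)) = 0 by rewrite mulrBl mulrA h; ring.
have mk : (m * k - 1)%N%:R = m%:R * k%:R - 1 :> rat.
  by rewrite natrB ?natrM //; lia.
rewrite -mk => /eqP; rewrite !mulf_eq0 pnatr_eq0 => /orP[|/orP[]] h'; last 2 first.
- by left. - by right.
by nia.
Qed.

(** * Excluding that y alone vanishes at the root of n *)

Lemma size2_root (x : {poly int}) : (size x <= 2)%N -> x`_0 * n1%:Z = x`_1 * n0%:Z -> root (pZQ x) rootn.
Proof.
move=> sx h; have n1Q : n1%:R != 0 :> rat by rewrite pnatr_eq0 -lt0n.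
rewrite (poly_size2 sx) rmorphD /= map_polyC map_polyZ map_polyX /= /root hornerD hornerC hornerZ hornerX /rootn.
apply/eqP; apply: (mulIf n1Q); rewrite mul0r mulrDl -mulrA divfK //.
move: (congr1 (fun t : int => t%:~R : rat) h); rewrite !rmorphM /= -!pmulrn => ->.
ring.
Qed.

(* [n = p0 + p1 X]; the residues of [1 / (n x z)] would have to be positive at the
   root of [n] and negative at both others, whereas they alternate along the line. *)
Lemma no_three_roots (M p0 p1 x0 x1 z0 z1 D : int) : 0 < M -> 0 < p1 -> 0 < x1 -> 0 < z1 -> 0 < D ->
  M * x1 * z1 = p1 * (x1 + z1) ->
  M * (x0 * z1 + x1 * z0) = p0 * (x1 + z1) + p1 * (x0 + z0) ->
  M * x0 * z0 = p0 * (x0 + z0) + D -> False.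
Proof.
move=> M0 p10 x10 z10 D0 e2 e1 e0.
(* The three identities evaluate M x z - n (x + z) = D at the roots of n, x and z, with denominators
   cleared. They give A B > 0, A C < 0 and B C > 0, although the product of the three is a
   square. *)
have eAB : M * ((p0 * x1 - p1 * x0) * (p0 * z1 - p1 * z0)) = p1 ^+ 2 * D.
  transitivity (p0 ^+ 2 * (M * x1 * z1) - p0 * p1 * (M * (x0 * z1 + x1 * z0)) + p1 ^+ 2 * (M * x0 * z0)); first by ring.
  by rewrite e2 e1 e0; ring.
have eAC : - ((p0 * x1 - p1 * x0) * (z0 * x1 - z1 * x0)) = x1 ^+ 2 * D.
  apply/eqP; rewrite -subr_eq0; apply/eqP.
  transitivity (x1 ^+ 2 * (M * x0 * z0 - (p0 * (x0 + z0) + D)) -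
    x0 * x1 * (M * (x0 * z1 + x1 * z0) - (p0 * (x1 + z1) + p1 * (x0 + z0)))
    + x0 ^+ 2 * (M * x1 * z1 - p1 * (x1 + z1))); first by ring.
  by rewrite e2 e1 e0 !subrr; ring.
have eBC : (p0 * z1 - p1 * z0) * (z0 * x1 - z1 * x0) = z1 ^+ 2 * D.
  apply/eqP; rewrite -subr_eq0; apply/eqP.
  transitivity (z1 ^+ 2 * (M * x0 * z0 - (p0 * (x0 + z0) + D)) -
    z0 * z1 * (M * (x0 * z1 + x1 * z0) - (p0 * (x1 + z1) + p1 * (x0 + z0)))
    + z0 ^+ 2 * (M * x1 * z1 - p1 * (x1 + z1))); first by ring.
  by rewrite e2 e1 e0 !subrr; ring.
move: eAB eAC eBC; set A := p0 * x1 - _; set B := p0 * z1 - _; set C := z0 * x1 - _ => eAB eAC eBC.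
have hAB : 0 < A * B by rewrite -(pmulr_rgt0 _ M0) eAB mulr_gt0 // exprn_gt0.
have hAC : 0 < - (A * C) by rewrite eAC mulr_gt0 // exprn_gt0.
have hBC : 0 < B * C by rewrite eBC mulr_gt0 // exprn_gt0.
have hP : 0 < A * B * (B * C) by exact: mulr_gt0.
have : A * B * (B * C) = - (B ^+ 2 * - (A * C)) by ring.
have := sqr_ge0 B; nia.
Qed.

Lemma m_ndvd_n1 : ~~ (m%:Z %| n1%:Z)%Z.
Proof.
rewrite dvdzE /=; apply/negP => dm; move: co1m; rewrite /coprime => /eqP g1.
have : (m %| gcdn n1 m)%N by rewrite dvdn_gcd dm dvdnn.
by rewrite g1 dvdn1; lia.
Qed.

(* [q0 + q1 X = m x z - n (x + z)] and [v0 + v1 X] is the other factor of [x z]; the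
   hypotheses force [x], [z] and the latter to share their root, so that
   [m V (n1 x0 - n0 x1) = n1 x], and the content of [x] gives [m | n1]. *)
Lemma no_double_root (v0 v1 q0 q1 x0 x1 z0 z1 : int) : 0 < v1 -> 0 < x1 -> 0 < z1 -> 0 < x0 -> 0 < z0 ->
  n0%:Z * x1 - n1%:Z * x0 != 0 -> n0%:Z * z1 - n1%:Z * z0 != 0 ->
  m%:Z * x1 * z1 = n1%:Z * (x1 + z1) ->
  q1 = m%:Z * (x0 * z1 + x1 * z0) - n0%:Z * (x1 + z1) - n1%:Z * (x0 + z0) ->
  q0 = m%:Z * x0 * z0 - n0%:Z * (x0 + z0) ->
  v1 * q1 = x1 * z1 -> v0 * q1 + v1 * q0 = x0 * z1 + x1 * z0 -> v0 * q0 = x0 * z0 -> False.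
Proof.
move=> v10 x10 z10 x00 z00 A0 B0 e2 e1 e0 f2 f1 f0.
set C := z0 * x1 - z1 * x0.
(* [eA] and [eB] evaluate q = m x z - n (x + z) at the roots of x and z, where it equals - n z and -
   n x; [gA] and [gB] evaluate V q = x z there. *)
have eA : - ((n0%:Z * x1 - n1%:Z * x0) * C) = x1 * (q0 * x1 - q1 * x0).
  apply/eqP; rewrite -subr_eq0; apply/eqP.
  transitivity (x0 ^+ 2 * (m%:Z * x1 * z1 - n1%:Z * (x1 + z1))); last by rewrite e2; ring.
  by rewrite e1 e0 /C; ring.
have eB : (n0%:Z * z1 - n1%:Z * z0) * C = z1 * (q0 * z1 - q1 * z0).
  apply/eqP; rewrite -subr_eq0; apply/eqP.
  transitivity (z0 ^+ 2 * (m%:Z * x1 * z1 - n1%:Z * (x1 + z1))); last by rewrite e2; ring.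
  by rewrite e1 e0 /C; ring.
have gA : (v0 * x1 - v1 * x0) * (q0 * x1 - q1 * x0) = 0.
  transitivity (x1 ^+ 2 * (v0 * q0) - x0 * x1 * (v0 * q1 + v1 * q0) + x0 ^+ 2 * (v1 * q1)); first by ring.
  by rewrite f0 f1 f2; ring.
have gB : (v0 * z1 - v1 * z0) * (q0 * z1 - q1 * z0) = 0.
  transitivity (z1 ^+ 2 * (v0 * q0) - z0 * z1 * (v0 * q1 + v1 * q0) + z0 ^+ 2 * (v1 * q1)); first by ring.
  by rewrite f0 f1 f2; ring.
(* If C is nonzero, the roots of x and z differ and q vanishes at neither, so the linear V would
   vanish at both. *)
have [C0|C0] := eqVneq C 0; last first.
  have hA : q0 * x1 - q1 * x0 != 0.
    apply: contra_neq C0 => h; apply: (mulfI A0); rewrite mulr0.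
    by apply: oppr_inj; rewrite eA h; ring.
  have hB : q0 * z1 - q1 * z0 != 0.
    by apply: contra_neq C0 => h; apply: (mulfI B0); rewrite eB h; ring.
  have vx : v0 * x1 - v1 * x0 = 0 by apply: (mulIf hA); rewrite gA mul0r.
  have vz : v0 * z1 - v1 * z0 = 0 by apply: (mulIf hB); rewrite gB mul0r.
  case/eqP: C0; apply: (mulfI (lt0r_neq0 v10)); rewrite mulr0.
  transitivity (z1 * (v0 * x1 - v1 * x0) - x1 * (v0 * z1 - v1 * z0)); first by rewrite /C; ring.
  by rewrite vx vz; ring.
have eC : z1 * x0 = z0 * x1 by apply/eqP; rewrite eq_sym -subr_eq0; apply/eqP.
have xz : n1%:Z * (x0 + z0) = m%:Z * x1 * z0.
  apply: (mulfI (lt0r_neq0 z10)).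
  transitivity (n1%:Z * (z1 * x0) + n1%:Z * z1 * z0); first by ring.
  rewrite eC; transitivity (z0 * (n1%:Z * (x1 + z1))); first by ring.
  by rewrite -e2; ring.
(* With x and z proportional, n1 q = m E z coefficientwise; inserting this in V q = x z gives m E V
   = n1 x. *)
set E := n1%:Z * x0 - n0%:Z * x1.
have q1E : n1%:Z * q1 = m%:Z * z1 * E.
  transitivity (n1%:Z * m%:Z * (x0 * z1 + x1 * z0) - n0%:Z * (n1%:Z * (x1 + z1)) - n1%:Z * (n1%:Z * (x0 + z0))).
    by rewrite e1; ring.
  by rewrite -e2 xz /E; ring.
have q0E : n1%:Z * q0 = m%:Z * z0 * E.
  transitivity (n1%:Z * m%:Z * x0 * z0 - n0%:Z * (n1%:Z * (x0 + z0))); first by rewrite e0; ring.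
  by rewrite xz /E; ring.
have vE1 : m%:Z * v1 * E = n1%:Z * x1.
  apply: (mulfI (lt0r_neq0 z10)); transitivity (v1 * (m%:Z * z1 * E)); first by ring.
  rewrite -q1E; transitivity (n1%:Z * (v1 * q1)); first by ring.
  by rewrite f2; ring.
have vE0 : m%:Z * v0 * E = n1%:Z * x0.
  apply: (mulfI (lt0r_neq0 z00)); transitivity (v0 * (m%:Z * z0 * E)); first by ring.
  rewrite -q0E; transitivity (n1%:Z * (v0 * q0)); first by ring.
  by rewrite f0; ring.
(* The content of x divides E, so a Bezout combination of the coefficients of m E V = n1 x can be
   divided by it, leaving m as a divisor of n1. *)
have [u [w uw]] : exists u w, u * x0 + w * x1 = gcdz x0 x1 by case: (Bezoutz x0 x1) => u [w]; exists u, w.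
have g0 : gcdz x0 x1 != 0 by rewrite gcdz_eq0; lia.
have /dvdzP[F EF] : (gcdz x0 x1 %| E)%Z.
  by rewrite /E rpredB // dvdz_mull ?dvdz_gcdl ?dvdz_gcdr.
have : (m%:Z %| n1%:Z)%Z.
  apply/dvdzP; exists (F * (u * v0 + w * v1)); apply: (mulIf g0).
  transitivity (u * (n1%:Z * x0) + w * (n1%:Z * x1)); first by rewrite -[gcdz _ _ in LHS]uw; ring.
  by rewrite -vE0 -vE1 EF; ring.
by rewrite (negPf m_ndvd_n1).
Qed.


Lemma coef0_mul (p q : {poly int}) : (p * q)`_0 = p`_0 * q`_0.
Proof. by rewrite coefM big_ord1. Qed.

Lemma coef1_mul (p q : {poly int}) : (p * q)`_1 = p`_0 * q`_1 + p`_1 * q`_0.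
Proof. by rewrite coefM big_ord_recl big_ord1. Qed.

Lemma coef2_mul (p q : {poly int}) : (size p <= 2)%N -> (size q <= 2)%N -> (p * q)`_2 = p`_1 * q`_1.
Proof.
move=> sp sq; rewrite coefM !big_ord_recl big_ord0 /=.
by rewrite (nth_default 0 sp) (nth_default 0 sq) /bump /=; ring.
Qed.

(** Cancelling n gives V P = x z of degree 2. If neither x nor z vanished at the root of n, each way
    to split this degree between V and P would be contradictory. *)
Lemma linear_root (x z V : {poly int}) : pos_poly x -> pos_poly z -> 0 < lead_coef V ->
  size x = 2%N -> size z = 2%N -> egypt_eq x (npoly n0 n1 * V) z -> root (pZQ x) rootn \/ root (pZQ z) rootn.
Proof.
move=> px pz lV sx sz e; set N := npoly n0 n1 in e.
have N0 : N != 0 := npoly_neq0.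
have [x0 z0] : x != 0 /\ z != 0 by case: px; case: pz.
have E : V * (m%:R * (x * z) - N * (x + z)) = x * z.
  apply: (mulfI N0); apply/eqP; rewrite -subr_eq0; apply/eqP.
  transitivity (m%:R * (x * (N * V) * z) - N * (N * V * z + x * z + x * (N * V))); first by ring.
  by rewrite e subrr.
case: (boolP (root (pZQ x) rootn)) => [|rx]; first by left.
case: (boolP (root (pZQ z) rootn)) => [|rz]; first by right.
exfalso.
have A0 : n0%:Z * x`_1 - n1%:Z * x`_0 != 0.
  by apply: contra rx => /eqP h; apply: size2_root; [rewrite sx | lia].
have B0 : n0%:Z * z`_1 - n1%:Z * z`_0 != 0.
  by apply: contra rz => /eqP h; apply: size2_root; [rewrite sz | lia].
set P : {poly int} := _ - _ in E.
have sxz : (size (x + z)%R <= 2)%N by rewrite (leq_trans (size_polyD _ _)) // sx sz.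
have sx2 : (size x <= 2)%N by rewrite sx.
have sz2 : (size z <= 2)%N by rewrite sz.
have P0 : P`_0 = m%:Z * x`_0 * z`_0 - n0%:Z * (x`_0 + z`_0).
  by rewrite coefB coef_natM !coef0_mul npoly_coef0 coefD mulrA.
have P1 : P`_1 = m%:Z * (x`_0 * z`_1 + x`_1 * z`_0) - n0%:Z * (x`_1 + z`_1) - n1%:Z * (x`_0 + z`_0).
  by rewrite coefB coef_natM !coef1_mul npoly_coef0 npoly_coef1 !coefD; ring.
have P2 : P`_2 = m%:Z * x`_1 * z`_1 - n1%:Z * (x`_1 + z`_1).
  by rewrite coefB coef_natM !coef2_mul // ?size_npoly // npoly_coef1 !coefD; ring.
have x0_gt0 : 0 < x`_0 by case: px => _; apply; rewrite sx.
have z0_gt0 : 0 < z`_0 by case: pz => _; apply; rewrite sz.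
have x1_gt0 : 0 < x`_1 by case: px => _; apply; rewrite sx.
have z1_gt0 : 0 < z`_1 by case: pz => _; apply; rewrite sz.
have P_neq0 : P != 0.
  by apply/eqP => P_0; move/eqP: E; rewrite P_0 mulr0 eq_sym mulf_eq0 (negPf x0) (negPf z0).
have V0 := lead_coef_gt0_neq0 lV.
have sV : (0 < size V)%N by rewrite size_poly_gt0.
have sP : (0 < size P)%N by rewrite size_poly_gt0.
have Pi i : (size P <= i)%N -> P`_i = 0 by exact: nth_default.
have sVP : (size V + size P)%N = 4%N.
  have h : (size V + size P).-1 = 3%N by rewrite -(size_mul V0 P_neq0) E size_mul // sx sz.
  by lia.
have [sV1|[sV2|sV3]] : size V = 1%N \/ size V = 2%N \/ size V = 3%N by lia.
(* For a constant V = v, evaluation at the root of n leaves (v m - 1) x z = 0, with no factor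
   zero. *)
- have VE : V = (V`_0)%:P by apply: size1_polyC; rewrite sV1.
  move: lV; rewrite VE lead_coefC; set v := V`_0 => v_gt0.
  have : (v * m%:Z - 1)%:P * (x * z) = N * (v%:P * (x + z)).
    apply/eqP; rewrite -subr_eq0; apply/eqP; transitivity (V * P - x * z); last by rewrite E subrr.
    by rewrite VE /P -/v polyCB polyCM polyC1 -(natz m) polyC_natr; ring.
  move/(congr1 (fun p : {poly int} => ev p)); rewrite rmorphM [in RHS]rmorphM hornerM [in RHS]hornerM.
  rewrite ev_npoly mul0r rmorphM hornerM /= map_polyC hornerC => /eqP; rewrite !mulf_eq0.
  move: rx rz; rewrite /root => /negPf -> /negPf ->; rewrite !orbF intr_eq0; nia.
- apply: (@no_double_root V`_0 V`_1 P`_0 P`_1 x`_0 x`_1 z`_0 z`_1) => //.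
  + by move: lV; rewrite lead_coefE sV2.
  + by apply/eqP; rewrite -subr_eq0 -P2 Pi //; lia.
  + by rewrite -!coef2_mul ?E //; lia.
  + by rewrite -!coef1_mul E.
  + by rewrite -!coef0_mul E.
have sP1 : size P = 1%N by lia.
have m_gt0 : 0 < m%:Z by lia.
apply: (@no_three_roots m%:Z n0%:Z n1%:Z x`_0 x`_1 z`_0 z`_1 P`_0) => //.
(* The constant P is positive because V, x and z have positive leading coefficients. *)
- have PE : P = (P`_0)%:P by apply: size1_polyC; rewrite sP1.
  have := congr1 (fun p : {poly int} => lead_coef p) E.
  rewrite /= !lead_coefM PE lead_coefC coefC /= => h.
  have xz_gt0 : 0 < lead_coef x * lead_coef z by rewrite mulr_gt0 ?pos_poly_lead_coef_gt0.
  by rewrite -(pmulr_rgt0 _ lV) h.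
- by apply/eqP; rewrite -subr_eq0 -P2 Pi //; lia.
- have : P`_1 = 0 by rewrite Pi //; lia.
  rewrite P1; lia.
by rewrite P0; ring.
Qed.

(** * Degrees of the solutions *)

(** In the sum of pairwise products nothing cancels at the top, so its degree is that of y z;
    comparison with x y z forces x to have degree 1. If z had degree above 1, then y z alone would
    supply the leading term, and m times the leading coefficient of x would be n1. *)
Lemma egypt_size2 (x y z : {poly int}) : 0 < lead_coef x -> 0 < lead_coef y -> 0 < lead_coef z ->
  egypt_eq x y z -> (size x <= size z <= size y)%N -> size x = 2%N /\ size z = 2%N.
Proof.
rewrite /egypt_eq -addrA => lx ly lz e /andP[sxz szy].
have [x0 [y0 z0]] : x != 0 /\ y != 0 /\ z != 0 by rewrite !lead_coef_gt0_neq0.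
have lM (p q : {poly int}) : 0 < lead_coef p -> 0 < lead_coef q -> 0 < lead_coef (p * q).
  by move=> lp lq; rewrite lead_coefM mulr_gt0.
have sx0 : (0 < size x)%N by rewrite size_poly_gt0.
have sy0 : (0 < size y)%N by rewrite size_poly_gt0.
have sz0 : (0 < size z)%N by rewrite size_poly_gt0.
have [lS sS] := size_add_lead_coef_gt0 (lM _ _ lx lz) (lM _ _ lx ly).
have [lT sT] := size_add_lead_coef_gt0 (lM _ _ ly lz) lS.
set T : {poly int} := y * z + _ in e lT sT *.
have m0 : m%:R != 0 :> int by lia.
move: sS sT; rewrite !size_mul // => sS sT.
have sx : size x = 2%N.
  have sL : size (m%:R * (x * y * z)) = ((size x + size y).-1 + size z).-1.
    by rewrite natM_scale size_scale // !size_mul ?mulf_neq0.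
  have sR : size (m%:R * (x * y * z)) = (size T).+1.
    by rewrite e size_mul ?npoly_neq0 ?lead_coef_gt0_neq0 // size_npoly.
  have h : ((size x + size y).-1 + size z).-1 =
      (maxn (size y + size z).-1 (maxn (size x + size z).-1 (size x + size y).-1)).+1.
    by rewrite -sS -sT -sR sL.
  lia.
split=> //; apply/eqP; rewrite eqn_leq; apply/andP; split; last by rewrite -sx.
rewrite leqNgt; apply/negP => sz.
have lt_aux (a b c : nat) : a = 2%N -> (2 < c)%N -> (c <= b)%N ->
    (maxn (a + c).-1 (a + b).-1 < (b + c).-1)%N by lia.
have lTE : lead_coef T = lead_coef y * lead_coef z.
  by rewrite lead_coefDl ?lead_coefM // sS size_mul //; apply: lt_aux.
have := congr1 (fun p : {poly int} => lead_coef p) e.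
rewrite /= natM_scale lead_coefZ !lead_coefM lTE lead_coef_npoly natz => h.
have : m%:Z * lead_coef x = n1%:Z.
  by apply: (mulIf (lt0r_neq0 (lM _ _ ly lz))); rewrite lead_coefM -h; ring.
move=> h'; case/negP: m_ndvd_n1; apply/dvdzP; exists (lead_coef x); rewrite -h'; ring.
Qed.

(** * Classification up to permutation *)

Definition param_form (x y z : {poly int}) := exists l k s r : nat, conds m n0 n1 l k s r /\
  perm_eq [:: x; y; z] [:: xsol n0 n1 k; ysol n0 n1 s r; zsol k l s r].

Lemma param_form_perm (x y z x' y' z' : {poly int}) : perm_eq [:: x; y; z] [:: x'; y'; z'] ->
  param_form x y z -> param_form x' y' z'.
Proof.
move=> p [l [k [s [r [c q]]]]]; exists l, k, s, r; split=> //.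
by rewrite perm_sym in p; exact: perm_trans p q.
Qed.

Lemma param_formC12 (x y z : {poly int}) : param_form x y z -> param_form y x z.
Proof. by apply: param_form_perm; apply/permP => a /=; rewrite addnCA. Qed.

Lemma param_formC23 (x y z : {poly int}) : param_form x y z -> param_form x z y.
Proof. by apply: param_form_perm; apply/permP => a /=; rewrite [(a y + _)%N]addnCA. Qed.

(** Here x = k n, so y or z also vanishes at the root of n; the second case is the first with y and
    z exchanged. *)
Lemma param_form_linear_root (x y z : {poly int}) : pos_poly x -> pos_poly y -> pos_poly z -> egypt_eq x y z ->
  size x = 2%N -> root (pZQ x) rootn -> param_form x y z.
Proof.
move=> px py pz e sx rx.
have [k k0 xE] := root_size2_xsol (pos_poly_lead_coef_gt0 px) sx rx.
have e' := e; rewrite xE in e'; case: (egypt_xsol_root k0 e') => h.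
  have [l [k' [s [r [c -> -> ->]]]]] := sol_of_two_roots px py pz e sx rx h.
  by exists l, k', s, r.
apply: param_formC23.
have [l [k' [s [r [c -> -> ->]]]]] := sol_of_two_roots px pz py (egypt_eqC23 e) sx rx h.
by exists l, k', s, r.
Qed.

(** The two smaller polynomials x and z are linear. When y vanishes at the root of n, [linear_root]
    makes one of them vanish there too, so a linear one always does. *)
Lemma param_form_sorted (x y z : {poly int}) : pos_poly x -> pos_poly y -> pos_poly z -> egypt_eq x y z ->
  (size x <= size z <= size y)%N -> param_form x y z.
Proof.
move=> px py pz e s.
have [lx ly lz] : [/\ 0 < lead_coef x, 0 < lead_coef y & 0 < lead_coef z].
  by split; apply: pos_poly_lead_coef_gt0.
have [sx sz] := egypt_size2 lx ly lz e s.
have hz : root (pZQ z) rootn -> param_form x y z.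
  move=> rz; apply: param_formC23; apply: param_formC12; apply: param_form_linear_root => //.
  by apply: egypt_eqC12; apply: egypt_eqC23.
have [rx|/dvd_npoly_root [V yE]|//] := egypt_root e; first exact: param_form_linear_root.
have lV : 0 < lead_coef V.
  by move: ly; rewrite yE lead_coefM lead_coef_npoly pmulr_rgt0 //; lia.
have e' := e; rewrite yE in e'; case: (linear_root px pz lV sx sz e') => // rx.
exact: param_form_linear_root.
Qed.

Lemma egypt_param_form (x y z : {poly int}) : pos_poly x -> pos_poly y -> pos_poly z -> egypt_eq x y z ->
  param_form x y z.
Proof.
move=> px py pz e.
have e132 := egypt_eqC23 e; have e213 := egypt_eqC12 e.
have e231 := egypt_eqC23 e213; have e312 := egypt_eqC12 e132; have e321 := egypt_eqC23 e312.
(* Of the eight outcomes two are cyclic, hence impossible; the other six are the orderings of the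
   sizes. *)
case: (leqP (size x) (size y)) => xy; case: (leqP (size y) (size z)) => yz;
  case: (leqP (size x) (size z)) => xz; try lia.
- by apply: param_formC23; apply: param_form_sorted => //; lia.
- by apply: param_form_sorted => //; lia.
- by apply: param_formC12; apply: param_formC23; apply: param_formC12; apply: param_form_sorted => //; lia.
- by apply: param_formC12; apply: param_formC23; apply: param_form_sorted => //; lia.
- by apply: param_formC12; apply: param_form_sorted => //; lia.
by apply: param_formC23; apply: param_formC12; apply: param_form_sorted => //; lia.
Qed.

(** * The parametric family solves the equation *)

Lemma pos_poly_linear (a b : int) : 0 < a -> 0 < b -> pos_poly (a%:P + b *: 'X).
Proof.
move=> a0 b0; have -> : a%:P + b *: 'X = Poly [:: a; b].
  by apply/polyP => -[|[|i]]; rewrite !coefE /= ?coef_Poly /= ?mulr0 ?addr0 ?mulr1 ?add0r ?nth_nil //.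
have b_neq0 : last 1 [:: a; b] != 0 by rewrite /= lt0r_neq0.
rewrite /pos_poly -size_poly_gt0 (PolyK b_neq0); split=> // -[|[|i]] //.
Qed.

Lemma pos_poly_mul_linear (a b c d : int) : 0 < a -> 0 < b -> 0 < c -> 0 < d ->
  pos_poly ((a%:P + b *: 'X) * (c%:P + d *: 'X)).
Proof.
move=> a0 b0 c0 d0.
have -> : (a%:P + b *: 'X) * (c%:P + d *: 'X) = Poly [:: a * c; a * d + b * c; b * d].
  rewrite /= !cons_poly_def -!mul_polyC mul0r add0r polyCD !polyCM; ring.
have b_neq0 : last 1 [:: a * c; a * d + b * c; b * d] != 0 by rewrite /= mulf_neq0 // lt0r_neq0.
rewrite /pos_poly -size_poly_gt0 (PolyK b_neq0); split=> // -[|[|[|i]]] //= _; nia.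
Qed.

(** With V = s + r X, the conditions amount to r z = k l V and n1 V = k l + r n; multiplying the
    equation by r avoids the quotient in [zsol]. *)
Lemma conds_sol l k s r : conds m n0 n1 l k s r ->
  [/\ pos_poly (xsol n0 n1 k), pos_poly (ysol n0 n1 s r), pos_poly (zsol k l s r)
    & egypt_eq (xsol n0 n1 k) (ysol n0 n1 s r) (zsol k l s r)].
Proof.
move=> [[l0 [k0 [s0 r0]]] c1 c2 /dvdnP [t tE]].
have t0 : (0 < t)%N by nia.
have zE : zsol k l s r = (t%:Z)%:P + (k * l)%N%:Z *: 'X by rewrite /zsol tE mulnK // !natz.
split.
- rewrite /xsol /npoly scalerDr scalerA -mul_polyC -polyCM -!natrM.
  by apply: pos_poly_linear; rewrite ltr0n; nia.
- by apply: pos_poly_mul_linear; rewrite ltr0n.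
- by rewrite zE; apply: pos_poly_linear; nia.
rewrite /egypt_eq xsolE /ysol; set V := _%:P + _; set N := npoly n0 n1.
have rz : r%:R * zsol k l s r = k%:R * l%:R * V.
  have tE' : s%:R * k%:R * l%:R = t%:R * r%:R :> {poly int} by rewrite -!natrM tE.
  rewrite /zsol tE mulnK // /V -!mul_polyC !polyC_natr natrM.
  transitivity (t%:R * r%:R + r%:R * k%:R * l%:R * 'X : {poly int}); first by ring.
  by rewrite -tE'; ring.
(* The constant coefficient is condition (ii); in degree 1 both sides are r n1. *)
have n1V : n1%:R * V = k%:R * l%:R + r%:R * N.
  have c2' : s%:R * n1%:R = k%:R * l%:R + r%:R * n0%:R :> {poly int} by rewrite -!natrM c2 natrD.
  rewrite /V /N /npoly -!mul_polyC !polyC_natr.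
  transitivity (s%:R * n1%:R + r%:R * n1%:R * 'X : {poly int}); first by ring.
  by rewrite c2'; ring.
have mk : (m * k - 1)%N%:R = m%:R * k%:R - 1 :> {poly int}.
  by rewrite natrB ?natrM //; lia.
have n1E : n1%:R = l%:R * (m%:R * k%:R - 1) :> {poly int} by rewrite {1}c1 natrM mk.
have r_neq0 : r%:R != 0 :> {poly int} by rewrite -polyC_natr polyC_eq0; lia.
apply: (mulfI r_neq0); apply/eqP; rewrite -subr_eq0; apply/eqP.
transitivity (N ^+ 2 * ((m%:R * k%:R - 1) * V * (r%:R * zsol k l s r) - k%:R * (r%:R * zsol k l s r) - k%:R * r%:R * N * V)).
  ring.
rewrite rz; transitivity (N ^+ 2 * k%:R * V * ((l%:R * (m%:R * k%:R - 1)) * V - (k%:R * l%:R + r%:R * N))); first by ring.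
by rewrite -n1E n1V subrr mulr0.
Qed.

End EgyptianFraction.

Theorem mainTheorem1 (m n0 n1 : nat)
  (hm : (4 <= m)%N) (hn0 : (0 < n0)%N) (hn1 : (0 < n1)%N)
  (hc0 : coprime n0 n1) (hc1 : coprime n1 m) :
  ((exists x y z : {poly int},
       [/\ pos_poly x, pos_poly y, pos_poly z & is_sol m n0 n1 x y z])
   <-> (exists l k s r : nat, conds m n0 n1 l k s r))
  /\ (forall l k s r : nat, conds m n0 n1 l k s r ->
        [/\ pos_poly (xsol n0 n1 k), pos_poly (ysol n0 n1 s r),
            pos_poly (zsol k l s r)
          & is_sol m n0 n1 (xsol n0 n1 k) (ysol n0 n1 s r) (zsol k l s r)])
  /\ (forall x y z : {poly int},
        pos_poly x -> pos_poly y -> pos_poly z -> is_sol m n0 n1 x y z ->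
        exists l k s r : nat, conds m n0 n1 l k s r /\
          perm_eq [:: x; y; z]
                  [:: xsol n0 n1 k; ysol n0 n1 s r; zsol k l s r]).
Proof.
have solE x y z : pos_poly x -> pos_poly y -> pos_poly z ->
    is_sol m n0 n1 x y z <-> egypt_eq m n0 n1 x y z.
  by move=> [x0 _] [y0 _] [z0 _]; apply: is_solE.
have sol l k s r : conds m n0 n1 l k s r ->
    [/\ pos_poly (xsol n0 n1 k), pos_poly (ysol n0 n1 s r), pos_poly (zsol k l s r)
      & is_sol m n0 n1 (xsol n0 n1 k) (ysol n0 n1 s r) (zsol k l s r)].
  by move=> /(conds_sol hn0 hn1 hc0 hm hc1) [px py pz e]; split=> //; apply/solE.
have form x y z : pos_poly x -> pos_poly y -> pos_poly z -> is_sol m n0 n1 x y z ->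
    param_form m n0 n1 x y z.
  by move=> px py pz /solE e; apply: egypt_param_form => //; apply: e.
split; last by split.
split=> [[x [y [z [px py pz /(form _ _ _ px py pz)]]]]|].
  by case=> l [k [s [r [c _]]]]; exists l, k, s, r.
by case=> l [k [s [r /sol h]]]; exists (xsol n0 n1 k), (ysol n0 n1 s r), (zsol k l s r).
Qed.
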